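(* Let $X$ be an integrable random variable (i.e. $\mathbb{E}[|X|]<\infty$), let $N\sim\mathcal{N}(0,1)$ be independent of $X$, and set $Y=X+N$. Then there is no polynomial $q$ with real coefficients and $\deg q\ge 2$ such that $\mathbb{E}[X\mid Y]=q(Y)$ almost surely. Moreover, if $X$ has finite variance, then $\mathbb{E}[X\mid Y]$ is almost surely equal to a polynomial in $Y$ if and only if $X$ is Gaussian or almost surely constant.
   Context: $\mathbb{E}[X\mid Y]$ denotes the conditional expectation of $X$ given $\sigma(Y)$. *)

(* Defs.v *)
From HB Require Import structures.
From mathcomp Require Import all_boot all_order all_algebra.
From mathcomp Require Import all_classical all_reals all_analysis.
Set Implicit Arguments. Unset Strict Implicit. Unset Printing Implicit Defensive.
Import Order.TTheory GRing.Theory Num.Theory.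
Local Open Scope classical_set_scope.
Local Open Scope ring_scope.

(* The law of Z : T -> R under P is the normal law N(m, s^2), s > 0. *)
Definition has_normal_law d (T : measurableType d) (R : realType)
    (P : probability T R) (Z : T -> R) (m s : R) :=
  forall B : set R, measurable B -> P (Z @^-1` B) = normal_prob m s B.

Definition indep_rv d (T : measurableType d) (R : realType)
    (P : probability T R) (X N : T -> R) :=
  forall A B : set R, measurable A -> measurable B ->
    P (X @^-1` A `&` N @^-1` B) = (P (X @^-1` A) * P (N @^-1` B))%E.

Definition sigmaY_measurable d (T : measurableType d) (R : realType)
    (Y Z : T -> R) :=
  forall A : set R, measurable A ->
    exists B : set R, measurable B /\ Z @^-1` A = Y @^-1` B.

(* Z is a version of the conditional expectation E[X | sigma(Y)]:
   Z is sigma(Y)-measurable, integrable, and has the same integrals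
   as X over every set of sigma(Y).  "E[X|Y] = Z a.s." means exactly this. *)
Definition is_cond_exp d (T : measurableType d) (R : realType)
    (P : probability T R) (X Y Z : T -> R) :=
  [/\ sigmaY_measurable Y Z,
      P.-integrable setT (fun w => (Z w)%:E) &
      forall B : set R, measurable B ->
        (\int[P]_(w in Y @^-1` B) (X w)%:E = \int[P]_(w in Y @^-1` B) (Z w)%:E)%E].

(* Main.v *)
Require Import Defs.
From HB Require Import structures.
From mathcomp Require Import all_boot all_order all_algebra.
From mathcomp Require Import all_classical all_reals all_analysis.
From mathcomp Require Import measurable_realfun polyrcf ring lra.
Set Implicit Arguments. Unset Strict Implicit. Unset Printing Implicit Defensive.
Import Order.TTheory GRing.Theory Num.Theory.
Import numFieldNormedType.Exports.
Local Open Scope classical_set_scope.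
Local Open Scope ring_scope.

(* Let w y x = exp (y x - x^2 / 2) and g y = E[w y X].  Since N is standard
   Gaussian, E[X | Y] = q(Y) holds iff E[(X - q y) w y X] = 0 for every y: the
   density of Y makes this true for almost every y, continuity for all of them.
   Integrating the tangent line of exp at the tilted mean q y then gives
   exp (e q y) * g y <= g (y + e) for all y, e.  Together with
   g y <= exp (y^2 / 2) this traps y * q y between y * q 0 and a quadratic, so
   deg q <= 1.  If q y = a y + b, the same inequality integrates to
   g y = g 0 * exp (a y^2 / 2 + b y) with 0 <= a < 1.  For a = 0 the function
   (x - b) (exp x - exp b) w 0 x >= 0 has zero mean, so X = b a.s.; for a > 0,
   g is proportional to the tilted mass of a normal law.

   Proportional tilted masses determine the law.  Derivatives in y produce
   x^k exp (y x - x^2 / 2), the exponential series produces exp (y x - m x^2)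
   for every m >= 1, and the exponential series again produces
   1 - exp (- exp (- n^2 ((x - a)^2 - r) - n)), which tends to the indicator
   function of the open interval (x - a)^2 < r.

   Conversely, for Gaussian X the tangent inequality leaves a y + b as the only
   possible value of the tilted mean. *)

(** * Tilted masses of a probability measure *)
Definition bounded_measurable d (T : measurableType d) (R : realType)
    (f : T -> R) :=
  measurable_fun setT f /\ exists M : R, forall x, `|f x| <= M.

Section bounded_measurable_theory.
Context d (T : measurableType d) (R : realType) (P : probability T R).
Implicit Types f g : T -> R.

Lemma bounded_measurable_integrable f :
  bounded_measurable f -> P.-integrable setT (EFin \o f).
Proof.
move=> [mf [M fM]]; apply: measurable_bounded_integrable => //.
  by rewrite (le_lt_trans (probability_le1 P measurableT))// ltry.
exists M; split; first exact: num_real.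
by move=> x Mx t _ /=; rewrite (le_trans (fM t))// ltW.
Qed.

Lemma bounded_measurable_cst (c : R) : bounded_measurable (fun _ : T => c).
Proof. by split => //; exists `|c|. Qed.

Lemma bounded_measurableD f g : bounded_measurable f -> bounded_measurable g ->
  bounded_measurable (fun x => f x + g x).
Proof.
move=> [mf [M fM]] [mg [N gN]]; split; first exact: measurable_funD.
by exists (M + N) => x; rewrite (le_trans (ler_normD _ _))// lerD.
Qed.

Lemma bounded_measurableM f g : bounded_measurable f -> bounded_measurable g ->
  bounded_measurable (fun x => f x * g x).
Proof.
move=> [mf [M fM]] [mg [N gN]]; split; first exact: measurable_funM.
by exists (M * N) => x; rewrite normrM ler_pM.
Qed.

Lemma bounded_measurableZ c f : bounded_measurable f ->
  bounded_measurable (fun x => c * f x).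
Proof. by apply: bounded_measurableM; exact: bounded_measurable_cst. Qed.

Lemma cvg_Rintegral_bounded (u : nat -> T -> R) f (M : R) :
  (forall n, measurable_fun setT (u n)) -> (forall n x, `|u n x| <= M) ->
  (forall x, u ^~ x @ \oo --> f x) ->
  (fun n => \int[P]_x u n x) @ \oo --> \int[P]_x f x.
Proof.
move=> mu uM uf.
have mf : measurable_fun setT f by apply: (measurable_fun_cvg mu) => x _; exact: uf.
have bf : bounded_measurable f.
  split => //; exists M => x.
  have /cvg_norm h := uf x.
  rewrite -(cvg_lim _ h)//; apply: limr_le; last exact: nearW.
  by apply/cvg_ex; eexists; exact: h.
have [||||_ _ H] := @dominated_convergence _ T R P setT measurableT
  (fun n => EFin \o u n) (EFin \o f) (cst M%:E) (fun n => (measurable_EFinP _ _).2 (mu n)).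
- exact/measurable_EFinP.
- by apply/aeW => x _; apply/fine_cvgP; split; [exact: nearW|exact: uf].
- exact: (bounded_measurable_integrable (bounded_measurable_cst M)).
- by apply/aeW => x n _; rewrite /= lee_fin.
by apply: fine_cvg; rewrite fineK//; apply: integrable_fin_num => //;
  exact: bounded_measurable_integrable.
Qed.

(** A zero integral would force [f] to vanish almost everywhere, so the whole space would be null,
    against total mass 1. *)
Lemma Rintegral_gt0 f : bounded_measurable f -> (forall x, 0 < f x) ->
  0 < \int[P]_x f x.
Proof.
move=> bf f0; rewrite lt_neqAle Rintegral_ge0 ?andbT//; last by move=> x _; exact: ltW.
apply/eqP => /esym If.
have fin := integrable_fin_num measurableT (bounded_measurable_integrable bf).
have I0 : (\int[P]_x `|(f x)%:E| = 0)%E.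
  under eq_integral do rewrite gee0_abs ?lee_fin ?ltW//.
  by rewrite -(fineK fin) /= -/(Rintegral P setT f) If.
have [mf _] := bf.
have mEf : measurable_fun setT (EFin \o f) by exact/measurable_EFinP.
have [N [mN PN subN]] := (ae_eq_integral_abs P measurableT mEf).1 I0.
have := probability_setT P.
suff -> : [set: T] = N by rewrite PN => /esym/eqP; rewrite onee_eq0.
apply/esym; rewrite -subTset => x _; apply: subN => /= /(_ I) [] /eqP.
by rewrite gt_eqF.
Qed.

End bounded_measurable_theory.

Section tilt.
Context (R : realType).
Implicit Types x y s : R.

(** The likelihood ratio of the observation [y] for signal [x] against signal 0, under unit Gaussian
    noise. *)
Definition tilt y x : R := expR (y * x - x ^+ 2 / 2).

Lemma measurable_expoly k y s :
  measurable_fun setT (fun x : R => x ^+ k * expR (y * x - s * x ^+ 2)).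
Proof.
apply: measurable_funM; first exact: measurable_funX.
apply: measurableT_comp => //; apply: measurable_funB.
  exact: measurable_funM.
by apply: measurable_funM => //; exact: measurable_funX.
Qed.

(** From |x|^k <= k! exp |x|, then completing the square in |x|. Only |y| enters the bound, so it is
    uniform for bounded [y]. *)
Lemma expoly_bound k y s x : 0 < s ->
  `|x ^+ k * expR (y * x - s * x ^+ 2)| <= k`!%:R * expR ((`|y| + 1) ^+ 2 / (4 * s)).
Proof.
move=> s0; rewrite normrM normrX (ger0_norm (expR_ge0 _)).
have kx : `|x| ^+ k <= k`!%:R * expR `|x|.
  case: k => [|k]; first by rewrite expr0 fact0 mul1r -expR0 ler_expR.
  rewrite -ler_pdivrMl ?ltr0n ?fact_gt0// mulrC.
  by have := expR_ge1Dxn k (normr_ge0 x); apply: le_trans; rewrite lerDr.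
apply: (le_trans (ler_wpM2r (expR_ge0 _) kx)).
rewrite -mulrA ler_wpM2l// -expRD ler_expR.
have yx : y * x <= `|y| * `|x| by rewrite -normrM ler_norm.
rewrite -(real_normK (num_real x)).
move: (`|x|) (`|y|) yx => a b yx.
rewrite ler_pdivlMr ?mulr_gt0//.
have : 0 <= (b + 1 - 2 * s * a) ^+ 2 by exact: sqr_ge0.
have : 0 <= 4 * s * (b * a - y * x) by rewrite !mulr_ge0 ?subr_ge0// ltW.
by rewrite !expr2; lra.
Qed.

Lemma bounded_measurable_expoly k y s : 0 < s ->
  bounded_measurable (fun x : R => x ^+ k * expR (y * x - s * x ^+ 2)).
Proof.
move=> s0; split; first exact: measurable_expoly.
by eexists => x; exact: expoly_bound.
Qed.

Lemma tiltE y x : tilt y x = x ^+ 0 * expR (y * x - 2^-1 * x ^+ 2).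
Proof. by rewrite /tilt expr0 mul1r [_ / 2]mulrC. Qed.

Lemma mul_tiltE y x : x * tilt y x = x ^+ 1 * expR (y * x - 2^-1 * x ^+ 2).
Proof. by rewrite /tilt expr1 [_ / 2]mulrC. Qed.

Lemma bounded_measurable_tilt y : bounded_measurable (tilt y).
Proof.
rewrite (_ : tilt y = fun x => x ^+ 0 * expR (y * x - 2^-1 * x ^+ 2)).
  by apply: bounded_measurable_expoly; rewrite invr_gt0.
by apply/funext => x; rewrite tiltE.
Qed.

Lemma bounded_measurable_mul_tilt y : bounded_measurable (fun x => x * tilt y x).
Proof.
rewrite (_ : (fun x => _) = fun x => x ^+ 1 * expR (y * x - 2^-1 * x ^+ 2)).
  by apply: bounded_measurable_expoly; rewrite invr_gt0.
by apply/funext => x; rewrite mul_tiltE.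
Qed.

Lemma bounded_measurable_sub_tilt r y :
  bounded_measurable (fun x => (x - r) * tilt y x).
Proof.
rewrite (_ : (fun x => _) = fun x => x * tilt y x + (- r) * tilt y x).
  apply: bounded_measurableD; first exact: bounded_measurable_mul_tilt.
  exact/bounded_measurableZ/bounded_measurable_tilt.
by apply/funext => x; rewrite mulrBl mulNr.
Qed.

Variable D : probability (measurableTypeR R) R.

Definition tilt_mass y : R := \int[D]_x tilt y x.

Lemma tilt_mass_gt0 y : 0 < tilt_mass y.
Proof.
apply: Rintegral_gt0; first exact: bounded_measurable_tilt.
by move=> x; exact: expR_gt0.
Qed.

Lemma tilt_mass_le y : tilt_mass y <= expR (y ^+ 2 / 2).
Proof.
have h x : tilt y x <= expR (y ^+ 2 / 2).
  rewrite /tilt ler_expR; have := sqr_ge0 (y - x); rewrite !expr2; lra.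
have -> : expR (y ^+ 2 / 2) = \int[D]_x expR (y ^+ 2 / 2).
  by rewrite Rintegral_cst// [X in fine X](probability_setT D) mulr1.
apply: le_Rintegral => //; apply: bounded_measurable_integrable.
  exact: bounded_measurable_tilt.
exact: bounded_measurable_cst.
Qed.

Lemma Rintegral_sub_tilt r y :
  \int[D]_x ((x - r) * tilt y x) = \int[D]_x (x * tilt y x) - r * tilt_mass y.
Proof.
rewrite /tilt_mass -RintegralZl//; last first.
  exact/bounded_measurable_integrable/bounded_measurable_tilt.
rewrite -RintegralB//.
- by apply: eq_Rintegral => x _; rewrite mulrBl.
- exact/bounded_measurable_integrable/bounded_measurable_mul_tilt.
- apply: bounded_measurable_integrable.
  exact/bounded_measurableZ/bounded_measurable_tilt.
Qed.

(* Integrate the tangent line inequality of the exponential at the tilted mean. *)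
Lemma tilt_mass_tangent r y e : \int[D]_x ((x - r) * tilt y x) = 0 ->
  expR (e * r) * tilt_mass y <= tilt_mass (y + e).
Proof.
move=> r0.
pose h x := expR (e * r) * tilt y x + expR (e * r) * e * ((x - r) * tilt y x).
have hle x : h x <= tilt (y + e) x.
  have -> : tilt (y + e) x = expR (e * r) * tilt y x * expR (e * (x - r)).
    by rewrite /tilt -!expRD; congr expR; ring.
  have -> : h x = expR (e * r) * tilt y x * (1 + e * (x - r)) by rewrite /h; ring.
  by rewrite ler_wpM2l ?mulr_ge0 ?expR_ge0// expR_ge1Dx.
have b1 := bounded_measurableZ (expR (e * r)) (bounded_measurable_tilt y).
have b2 := bounded_measurableZ (expR (e * r) * e) (bounded_measurable_sub_tilt r y).
have -> : expR (e * r) * tilt_mass y = \int[D]_x h x.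
  rewrite RintegralD ?bounded_measurable_integrable//; [|exact: bounded_measurable_integrable..].
  rewrite !RintegralZl// ?r0 ?mulr0 ?addr0//; apply: bounded_measurable_integrable.
    exact: bounded_measurable_sub_tilt.
  exact: bounded_measurable_tilt.
apply: le_Rintegral => //; apply: bounded_measurable_integrable.
  exact: bounded_measurableD.
exact: bounded_measurable_tilt.
Qed.

End tilt.

(* Chaining n steps of length (z - y) / n loses only the factor exp(- c (z - y)^2 / n). *)
Lemma le_of_quadratic_loss (R : realType) (h : R -> R) (c : R) :
  (forall y e, h y * expR (- (c * e ^+ 2)) <= h (y + e)) ->
  forall y z, h y <= h z.
Proof.
move=> hc y z.
have chain k y0 e : h y0 * expR (- (c * e ^+ 2 * k%:R)) <= h (y0 + e *+ k).
  elim: k => [|k IH]; first by rewrite mulr0 oppr0 expR0 mulr1 mulr0n addr0.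
  rewrite [e *+ k.+1]mulrSr addrA; apply: le_trans (hc _ _).
  apply: le_trans (ler_wpM2r (expR_ge0 _) IH).
  by rewrite -[leRHS]mulrA -expRD -natr1 mulrDr mulr1 opprD.
pose u n := h y * expR (- (c * (z - y) ^+ 2) * (n.+1%:R)^-1).
have uz n : u n <= h z.
  have n0 : (n.+1%:R : R) != 0 by rewrite pnatr_eq0.
  have E : ((z - y) / n.+1%:R) *+ n.+1 = z - y by rewrite -mulr_natr divfK.
  have := chain n.+1 y ((z - y) / n.+1%:R).
  rewrite E subrKC; apply: le_trans.
  rewrite /u le_eqVlt; apply/orP; left; apply/eqP; congr (_ * expR _).
  by field.
have ulim : u @ \oo --> h y.
  have -> : h y = h y * expR (- (c * (z - y) ^+ 2) * 0) by rewrite mulr0 expR0 mulr1.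
  apply: cvgMl_tmp; apply: continuous_cvg; first exact: continuous_expR.
  by apply: cvgMl_tmp; exact: cvg_harmonic.
rewrite -(cvg_lim _ ulim)//; apply: limr_le; first by apply/cvg_ex; exists (h y).
exact: nearW.
Qed.

(** Bumps drifting to infinity in the direction [s], which is 1 or -1; (1 - s (s n - x))^2 >= 0
    bounds the exponent by an affine function of n. *)
Lemma cvg_gauss_drift (R : realType) (s x : R) : s ^+ 2 = 1 ->
  (fun n : nat => expR (- ((x - s * n%:R) ^+ 2 / 2))) @ \oo --> (0 : R).
Proof.
move=> s1; apply: (@squeeze_cvgr _ _ _ _ (fun=> 0)
    (fun n : nat => expR (s * x + 2^-1) * expR (- n%:R))).
- apply: nearW => n; rewrite expR_ge0/= -expRD ler_expR.
  have : 0 <= (1 - s * (s * n%:R - x)) ^+ 2 by exact: sqr_ge0.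
  have -> : (1 - s * (s * n%:R - x)) ^+ 2 =
    1 - 2 * (s ^+ 2 * n%:R - s * x) + s ^+ 2 * (x - s * n%:R) ^+ 2 by ring.
  rewrite s1; lra.
- exact: cvg_cst.
- have -> : (0 : R) = expR (s * x + 2^-1) * 0 by rewrite mulr0.
  by apply: cvgMl_tmp; exact: cvgn_expR.
Qed.

(** * Polynomial and affine posterior means *)

Section posterior_mean.
Context (R : realType) (D : probability (measurableTypeR R) R).
Local Notation g := (tilt_mass D).

(** The bound [lo] comes from going from 0 to y and back, [hi] from going on from y to 2 y. In
    degree at least 2, a negative leading coefficient contradicts [lo] and a positive one [hi]. *)
Lemma tilt_poly_size (q : {poly R}) :
  (forall y, \int[D]_x ((x - q.[y]) * tilt y x) = 0) -> (size q <= 2)%N.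
Proof.
move=> H; rewrite leqNgt; apply/negP => q3.
have T y e := @tilt_mass_tangent R D q.[y] y e (H y).
have lo y : 1 <= y -> q.[0] <= q.[y].
  move=> y1; have y0 : 0 < y by rewrite (lt_le_trans _ y1).
  have := T y (- y); rewrite subrr => h1.
  have := T 0 y; rewrite add0r => h2.
  have := le_trans (ler_wpM2l (expR_ge0 _) h2) h1.
  rewrite mulrA ger_pMl ?tilt_mass_gt0// -expRD expR_le1 mulNr addrC subr_le0.
  by rewrite ler_pM2l.
pose K := `|q.[0]| + `|ln (g 0)|.
have hi y : 1 <= y -> q.[y] <= 2 * y + K.
  move=> y1; have y0 : 0 < y by rewrite (lt_le_trans _ y1).
  have h1 := T y y.
  have := T 0 y; rewrite add0r => h2.
  have := le_trans (le_trans (ler_wpM2l (expR_ge0 _) h2) h1) (tilt_mass_le _ _).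
  rewrite -[X in _ * (_ * X) <= _]lnK ?posrE ?tilt_mass_gt0// -!expRD ler_expR => h3.
  rewrite -(ler_pM2l y0); move: h3.
  rewrite /K; move: (ln (g 0)) (q.[0]) => L q0 h3.
  have h4 : - (y * q0) <= y * `|q0|.
    by rewrite -mulrN ler_wpM2l ?(ltW y0)// -normrN ler_norm.
  have h5 : - L <= `|L| by rewrite -normrN ler_norm.
  have h6 : `|L| <= y * `|L| by rewrite ler_peMl.
  have -> : y * (2 * y + (`|q0| + `|L|)) = 2 * y * y + y * `|q0| + y * `|L| by ring.
  have e2 : (y + y) ^+ 2 / 2 = 2 * y * y by field.
  rewrite e2 -lerBrDr in h3; apply: (le_trans h3).
  by rewrite -addrA lerD2l opprD lerD// (le_trans h5).
have lcq : lead_coef q != 0 by rewrite lead_coef_eq0 -size_poly_gt0 (leq_trans _ q3).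
have [lc0|lc0] := ltP 0 (lead_coef q).
  (* [p] has the leading coefficient of [q], so it is eventually at least that positive number,
     whereas [hi] makes it nonpositive from 1 on. *)
  pose p := q - (2%:P * 'X + K%:P).
  have sz : (size (2%:P * 'X + K%:P : {poly R})%R < size q)%N.
    rewrite size_MXaddC; case: ifP => _; rewrite (leq_trans _ q3)// ltnS size_polyC.
    by case: (_ != _).
  have lp : lead_coef p = lead_coef q by rewrite lead_coefDl// size_polyN.
  have [] := @poly_pinfty_gt_lc R p; first by rewrite lp.
  move=> n hn; have := hn (Num.max n 1); rewrite le_max lexx => /(_ isT).
  have := hi (Num.max n 1); rewrite le_max lexx orbT => /(_ isT).
  rewrite lp /p !hornerE; lra.
pose p := q.[0]%:P - q.
have lp : lead_coef p = - lead_coef q.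
  rewrite /p addrC lead_coefDl ?lead_coefN// size_polyN.
  by rewrite (leq_ltn_trans (size_polyC_leq1 _))// (leq_trans _ q3).
have [] := @poly_pinfty_gt_lc R p; first by rewrite lp oppr_gt0 lt_neqAle lcq.
move=> n hn; have := hn (Num.max n 1); rewrite le_max lexx => /(_ isT).
have := lo (Num.max n 1); rewrite le_max lexx orbT => /(_ isT).
have : lead_coef q < 0 by rewrite lt_neqAle lcq.
rewrite lp /p !hornerE; lra.
Qed.

Section affine.
Variables a b : R.
Hypothesis H : forall y, \int[D]_x ((x - (a * y + b)) * tilt y x) = 0.

(** No derivative of [g] is taken: divided by the candidate exponential, [g] satisfies the
    hypothesis of [le_of_quadratic_loss] with constant a / 2, hence is constant. *)
Lemma tilt_mass_affine y : g y = g 0 * expR (a * y ^+ 2 / 2 + b * y).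
Proof.
pose h z := g z * expR (- (a * z ^+ 2 / 2 + b * z)).
have hc z e : h z * expR (- (a / 2 * e ^+ 2)) <= h (z + e).
  rewrite /h -mulrA -expRD.
  have -> : - (a * z ^+ 2 / 2 + b * z) - a / 2 * e ^+ 2 =
     e * (a * z + b) - (a * (z + e) ^+ 2 / 2 + b * (z + e)) by field.
  rewrite expRD mulrA [g z * _]mulrC ler_wpM2r ?expR_ge0//.
  exact: tilt_mass_tangent.
have E : h y = h 0 by apply/eqP; rewrite eq_le !(le_of_quadratic_loss hc).
move: E; rewrite /h expr0n/= !mulr0 mul0r addr0 oppr0 expR0 mulr1 => <-.
by rewrite -mulrA -expRD addrC subrr expR0 mulr1.
Qed.

(** The tangent bounds from 0 to 1 and back multiply to exp (- a) <= 1. *)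
Lemma slope_ge0 : 0 <= a.
Proof.
have T y e := @tilt_mass_tangent R D (a * y + b) y e (H y).
have := T 1 (- 1); rewrite subrr => h1.
have := T 0 1; rewrite add0r => h2.
have := le_trans (ler_wpM2l (expR_ge0 _) h2) h1.
by rewrite mulrA ger_pMl ?tilt_mass_gt0// -expRD expR_le1; lra.
Qed.

(** If a >= 1, the integral of the bump centred at s n equals g 0 exp ((a - 1) n^2 / 2 + s b n) >= g
    0, yet it tends to 0 by dominated convergence. *)
Lemma slope_lt1 : a < 1.
Proof.
rewrite ltNge; apply/negP => a1.
(* The bumps move to the side where the linear term of the exponent is nonnegative. *)
have [s s1 sb] : exists2 s : R, s ^+ 2 = 1 & 0 <= s * b.
  have [b0|b0] := leP 0 b; first by exists 1; rewrite ?expr1n ?mul1r.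
  by exists (-1); rewrite ?sqrrN ?expr1n// mulN1r oppr_ge0 ltW.
have bound (n : nat) x : `|expR (- ((x - s * n%:R) ^+ 2 / 2))| <= 1.
  by rewrite ger0_norm ?expR_ge0// expR_le1 oppr_le0 divr_ge0// sqr_ge0.
have mu (n : nat) : measurable_fun setT (fun x : R => expR (- ((x - s * n%:R) ^+ 2 / 2))).
  apply: measurableT_comp => //; apply: measurableT_comp => //.
  by apply: measurable_funM => //; apply: measurable_funX; exact: measurable_funB.
have := cvg_Rintegral_bounded (P := D) mu bound (fun x => cvg_gauss_drift x s1).
rewrite Rintegral_cst// mul0r => lim0.
have E (n : nat) : \int[D]_x expR (- ((x - s * n%:R) ^+ 2 / 2)) =
    g (s * n%:R) * expR (- (n%:R ^+ 2 / 2)).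
  rewrite /g -RintegralZr//; last exact/bounded_measurable_integrable/bounded_measurable_tilt.
  apply: eq_Rintegral => x _; rewrite /tilt -expRD; congr expR.
  by rewrite sqrrB exprMn s1; field.
have : g 0 <= 0.
  rewrite -[leRHS](cvg_lim _ lim0)//; apply: limr_ge.
    by apply/cvg_ex; eexists; exact: lim0.
  apply: nearW => n; rewrite E (tilt_mass_affine (s * _)) -[leRHS]mulrA -expRD.
  rewrite ler_peMr ?(ltW (tilt_mass_gt0 _ _))//.
  rewrite -[leLHS]expR0 ler_expR exprMn s1.
  have -> : a * (1 * n%:R ^+ 2) / 2 + b * (s * n%:R) - n%:R ^+ 2 / 2 =
    (a - 1) * (n%:R ^+ 2) / 2 + (s * b) * n%:R by field.
  apply: addr_ge0; last exact: mulr_ge0.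
  by apply: divr_ge0 => //; apply: mulr_ge0; rewrite ?subr_ge0 ?sqr_ge0.
by rewrite leNgt tilt_mass_gt0.
Qed.

End affine.

Lemma posterior_const (b : R) :
  (forall y, \int[D]_x ((x - b) * tilt y x) = 0) -> D [set b] = 1%E.
Proof.
move=> H.
(* The integrand at 1 minus exp b times the integrand at 0. As tilt 1 x = exp x * tilt 0 x, this
   leaves two factors of equal sign, x - b and exp x - exp b. *)
pose f x := (x - b) * tilt 1 x + (- expR b) * ((x - b) * tilt 0 x).
have fE x : f x = (x - b) * (expR x - expR b) * tilt 0 x.
  rewrite /f /tilt mul0r mul1r expRD add0r; ring.
have f0 x : 0 <= f x.
  rewrite fE mulr_ge0 ?expR_ge0//; have [xb|xb] := leP b x.
    by rewrite mulr_ge0 ?subr_ge0 ?ler_expR.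
  by rewrite mulr_le0 ?subr_le0 ?ler_expR ?ltW.
have bf : bounded_measurable f.
  apply: bounded_measurableD; first exact: bounded_measurable_sub_tilt.
  exact/bounded_measurableZ/bounded_measurable_sub_tilt.
have If : \int[D]_x f x = 0.
  rewrite RintegralD//; last 2 first.
  - exact/bounded_measurable_integrable/bounded_measurable_sub_tilt.
  - exact/bounded_measurable_integrable/bounded_measurableZ/bounded_measurable_sub_tilt.
  rewrite RintegralZl// ?H ?mulr0 ?addr0//.
  exact/bounded_measurable_integrable/bounded_measurable_sub_tilt.
have fin := integrable_fin_num measurableT (@bounded_measurable_integrable _ _ _ D _ bf).
have I0 : (\int[D]_x `|(f x)%:E| = 0)%E.
  under eq_integral do rewrite gee0_abs ?lee_fin//.
  by rewrite -(fineK fin) /= -/(Rintegral D setT f) If.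
have [mf _] := bf.
have mEf : measurable_fun setT (EFin \o f) by exact/measurable_EFinP.
have [N [mN DN subN]] := (ae_eq_integral_abs D measurableT mEf).1 I0.
have mb : measurable (~` [set b]) by apply: measurableC; exact: measurable_set1.
have Cb : D (~` [set b]) = 0%E.
  apply/eqP; rewrite eq_le measure_ge0 andbT -DN le_measure ?inE//.
  move=> x /= xb; apply: subN => /= /(_ I) [].
  move/eqP; rewrite fE !mulf_eq0 !subr_eq0 [X in _ || X]gt_eqF ?expR_gt0// orbF.
  by case/orP => /eqP; [|move/expR_inj].
by have := @probability_setC _ _ _ D _ mb; rewrite setCK Cb sube0.
Qed.

(** The tangent bound at the true tilted mean [r], with the explicit [g], reads e (r - (a y + b)) <=
    a e^2 / 2 for every e, which forces r = a y + b. *)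
Lemma posterior_mean_gaussian (K a b y : R) : 0 <= a ->
  (forall z, g z = K * expR (a * z ^+ 2 / 2 + b * z)) ->
  \int[D]_x ((x - (a * y + b)) * tilt y x) = 0.
Proof.
move=> a0 gE.
pose r := (\int[D]_x (x * tilt y x)) / g y.
have gy0 : g y != 0 by rewrite gt_eqF ?tilt_mass_gt0.
have Hr : \int[D]_x ((x - r) * tilt y x) = 0.
  by rewrite Rintegral_sub_tilt /r divfK// subrr.
have ineq e : e * (r - (a * y + b)) <= a * e ^+ 2 / 2.
  have := tilt_mass_tangent e Hr.
  have -> : g (y + e) = expR (a * e ^+ 2 / 2 + e * (a * y + b)) * g y.
    by rewrite !gE [RHS]mulrC -[RHS]mulrA -expRD; congr (_ * expR _); field.
  rewrite ler_pM2r ?tilt_mass_gt0// ler_expR; lra.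
have a1 : 0 < a + 1 by rewrite ltr_wpDl.
suff <- : r = a * y + b by [].
apply/eqP; rewrite -subr_eq0 -sqrf_eq0; set w := r - _ in ineq *.
rewrite eq_le sqr_ge0 andbT.
(* Dividing by a + 1 rather than a also covers a = 0; the result is (a + 1) w^2 <= a w^2 / 2. *)
have := ineq (w / (a + 1)); rewrite -(ler_pM2r (exprn_gt0 2 a1)).
have -> : w / (a + 1) * w * (a + 1) ^+ 2 = w ^+ 2 * (a + 1) by field; rewrite gt_eqF.
have -> : a * (w / (a + 1)) ^+ 2 / 2 * (a + 1) ^+ 2 = a * w ^+ 2 / 2 by field; rewrite gt_eqF.
by have := mulr_ge0 a0 (sqr_ge0 w); lra.
Qed.

End posterior_mean.

(** * Uniqueness of the law with given tilted masses *)
Section exp_estimates.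
Context (R : realType).
Implicit Types x v : R.

Lemma expRB1_le v : expR v - 1 <= v * expR v.
Proof.
have := expR_ge1Dx (- v); rewrite -(ler_pM2r (expR_gt0 v)) -expRD addNr expR0.
lra.
Qed.

Lemma norm_expRB1_le v : `|expR v - 1| <= `|v| * expR `|v|.
Proof.
have l := expR_ge1Dx v; have u := expRB1_le v.
have [v0|v0] := leP 0 v; first by rewrite (ger0_norm v0) ger0_norm; lra.
have v1 : expR v <= 1 by rewrite expR_le1 ltW.
rewrite ler0_norm ?subr_le0// (ltr0_norm v0).
have e1 : 1 <= expR (- v) by rewrite -expR0 ler_expR oppr_ge0 ltW.
have : - v * 1 <= - v * expR (- v) by rewrite ler_wpM2l// oppr_ge0 ltW.
lra.
Qed.

(** 0 <= exp v - 1 - v <= v (exp v - 1), and |exp v - 1| <= |v| exp |v|. *)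
Lemma expR_taylor1 v : `|expR v - 1 - v| <= v ^+ 2 * expR `|v|.
Proof.
have l := expR_ge1Dx v; have u := expRB1_le v.
rewrite ger0_norm; last by lra.
apply: (@le_trans _ _ (v * (expR v - 1))); first by lra.
apply: (le_trans (ler_norm _)); rewrite normrM.
apply: (le_trans (ler_wpM2l (normr_ge0 _) (norm_expRB1_le v))).
by rewrite mulrA -expr2 real_normK// num_real.
Qed.

(** The quotients lie within c / (n + 1) of x, by the Taylor bound. They serve to differentiate
    tilts in y. *)
Lemma cvg_expR_slope x :
  (fun n : nat => n.+1%:R * (expR (n.+1%:R^-1 * x) - 1)) @ \oo --> x.
Proof.
have n0 (n : nat) : (n.+1%:R : R) != 0 by rewrite pnatr_eq0.
have lim (c : R) : (fun n : nat => x + c * n.+1%:R^-1) @ \oo --> x.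
  have : (fun n : nat => x + c * n.+1%:R^-1) @ \oo --> x + c * 0.
    by apply: cvgD; [exact: cvg_cst|apply: cvgMl_tmp; exact: cvg_harmonic].
  by rewrite mulr0 addr0.
pose c := x ^+ 2 * expR `|x|.
apply: (squeeze_cvgr _ (lim (- c)) (lim c)); apply: nearW => n.
set v := n.+1%:R^-1 * x.
have xv : x = n.+1%:R * v by rewrite /v mulVKf.
have : `|n.+1%:R * (expR v - 1) - x| <= c * n.+1%:R^-1.
  have -> : n.+1%:R * (expR v - 1) - x = n.+1%:R * (expR v - 1 - v) by rewrite [RHS]mulrBr -xv.
  rewrite normrM ger0_norm//.
  have h := ler_wpM2l (ler0n R n.+1) (expR_taylor1 v).
  apply: (le_trans h).
  have -> : n.+1%:R * (v ^+ 2 * expR `|v|) = x ^+ 2 / n.+1%:R * expR `|v|.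
    by rewrite /v; field.
  rewrite /c [leRHS]mulrAC ler_wpM2l ?divr_ge0 ?sqr_ge0// ler_expR.
  rewrite /v normrM ger0_norm ?invr_ge0// ler_piMl// invf_le1 ?ltr0n// ler1n//.
rewrite ler_norml lerBrDr => /andP[]; rewrite lerBlDr => h1 h2; apply/andP; split.
  by rewrite mulNr [leLHS]addrC.
by rewrite [leRHS]addrC.
Qed.

(** Supplies the domination for exchanging the exponential series with an integral. *)
Lemma series_exp_coeff_norm_le x n : `|series (exp_coeff x) n| <= expR `|x|.
Proof.
rewrite /series /=; apply: (le_trans (ler_norm_sum _ _ _)).
have -> : \sum_(0 <= k < n) `|exp_coeff x k| = series (exp_coeff `|x|) n.
  by apply: eq_bigr => k _; rewrite /exp_coeff /= normrM normrX [X in _ * X]ger0_norm.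
rewrite /expR; apply: nondecreasing_cvgn_le; last exact: is_cvg_series_exp_coeff.
by apply/nondecreasing_seqP => k; rewrite seriesEnat/= big_nat_recr//= lerDl exp_coeff_ge0.
Qed.

Lemma cvg_series_exp_coeff x : series (exp_coeff x) @ \oo --> expR x.
Proof. exact: is_cvg_series_exp_coeff. Qed.

End exp_estimates.

Section uniqueness.
Context (R : realType) (D1 D2 : probability (measurableTypeR R) R) (c : R).
Implicit Types (f g : R -> R) (x y s t : R).

(** The ratio [c] stays free because tilted masses are known only up to a factor; [agree_c] finally
    shows that it is 1. *)
Definition agree f :=
  bounded_measurable f /\ \int[D1]_x f x = c * \int[D2]_x f x.

Lemma agreeD f g : agree f -> agree g -> agree (fun x => f x + g x).
Proof.
move=> [bf If] [bg Ig]; split; first exact: bounded_measurableD.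
have i1 := bounded_measurable_integrable D1 bf.
have i2 := bounded_measurable_integrable D2 bf.
have j1 := bounded_measurable_integrable D1 bg.
have j2 := bounded_measurable_integrable D2 bg.
by rewrite (RintegralD measurableT i1 j1) (RintegralD measurableT i2 j2) If Ig mulrDr.
Qed.

Lemma agreeZ (k : R) f : agree f -> agree (fun x => k * f x).
Proof.
move=> [bf If]; split; first exact: bounded_measurableZ.
have i1 := bounded_measurable_integrable D1 bf.
have i2 := bounded_measurable_integrable D2 bf.
by rewrite (RintegralZl _ measurableT i1) (RintegralZl _ measurableT i2) If mulrCA.
Qed.

(** Asking agreement only for i >= m allows sums starting at 1: constants are not known to agree
    before [agree_cst1]. *)
Lemma agree_sum (u : nat -> R -> R) m n : (forall i, (m <= i)%N -> agree (u i)) ->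
  agree (fun x => \sum_(m <= i < n) u i x).
Proof.
move=> hu; elim: n => [|n IH].
  under eq_fun do rewrite big_geq//.
  split; first exact: bounded_measurable_cst.
  by rewrite !Rintegral_cst// !mul0r mulr0.
have [mn|nm] := leqP m n.
  under eq_fun do rewrite big_nat_recr//=.
  by apply: agreeD => //; exact: hu.
under eq_fun do rewrite big_geq//.
split; first exact: bounded_measurable_cst.
by rewrite !Rintegral_cst// !mul0r mulr0.
Qed.

Lemma agree_lim (u : nat -> R -> R) f (M : R) : (forall n, agree (u n)) ->
  (forall n x, `|u n x| <= M) -> (forall x, u ^~ x @ \oo --> f x) -> agree f.
Proof.
move=> au uM uf; have mu n : measurable_fun setT (u n) by have [[]] := au n.
have l1 := cvg_Rintegral_bounded (P := D1) mu uM uf.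
have l2 := cvg_Rintegral_bounded (P := D2) mu uM uf.
split; last first.
  have l3 : (fun n => c * \int[D2]_x u n x) @ \oo --> c * \int[D2]_x f x by apply: cvgMl_tmp.
  have E : (fun n => \int[D1]_x u n x) = (fun n => c * \int[D2]_x u n x).
    by apply/funext => n; have [_] := au n.
  by rewrite -E in l3; exact: (cvg_unique _ l1 l3).
split; first by apply: (measurable_fun_cvg mu) => x _; exact: uf.
exists M => x; have /cvg_norm h := uf x.
rewrite -(cvg_lim _ h)//; apply: limr_le; last exact: nearW.
by apply/cvg_ex; eexists; exact: h.
Qed.

Definition expoly k y s x : R := x ^+ k * expR (y * x - s * x ^+ 2).

(** Differentiation in y: difference quotients with step 1 / (n + 1) produce one more factor x in
    the limit. *)
Lemma agree_expolyS k s : 0 < s -> (forall y, agree (expoly k y s)) ->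
  forall y, agree (expoly k.+1 y s).
Proof.
move=> s0 ak y.
pose u (n : nat) x := n.+1%:R * (expoly k (y + n.+1%:R^-1) s x + -1 * expoly k y s x).
have uE n x : u n x = expoly k y s x * (n.+1%:R * (expR (n.+1%:R^-1 * x) - 1)).
  rewrite /u /expoly.
  have -> : (y + n.+1%:R^-1) * x - s * x ^+ 2 = (y * x - s * x ^+ 2) + n.+1%:R^-1 * x by ring.
  by rewrite expRD; ring.
pose B (z : R) : R := k.+1`!%:R * expR ((`|z| + 1) ^+ 2 / (4 * s)).
apply: (@agree_lim u _ (B (y + 1) + B (y - 1))).
- by move=> n; apply: agreeZ; apply: agreeD; [exact: ak|apply: agreeZ; exact: ak].
- move=> n x; rewrite uE normrM.
  have h : `|n.+1%:R * (expR (n.+1%:R^-1 * x) - 1)| <= `|x| * expR `|x|.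
    rewrite normrM ger0_norm//.
    apply: (le_trans (ler_wpM2l (ler0n _ _) (norm_expRB1_le _))).
    rewrite normrM ger0_norm ?invr_ge0// mulrA mulVKf ?pnatr_eq0// ler_wpM2l// ler_expR.
    by rewrite ler_piMl// invf_le1 ?ltr0n// ler1n.
  apply: (le_trans (ler_wpM2l (normr_ge0 _) h)).
  have sh e : `|expoly k y s x| * (`|x| * expR (e * x)) =
      `|x ^+ k.+1 * expR ((y + e) * x - s * x ^+ 2)|.
    have -> : (y + e) * x - s * x ^+ 2 = (y * x - s * x ^+ 2) + e * x by ring.
    by rewrite /expoly [in RHS]expRD (exprSr x k) !normrM !(ger0_norm (expR_ge0 _)); ring.
  have bound e : `|x| = e * x -> `|expoly k y s x| * (`|x| * expR `|x|) <= B (y + e).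
    by move=> xe; rewrite [in expR _]xe sh; exact: expoly_bound.
  have B0 z : 0 <= B z by rewrite mulr_ge0 ?expR_ge0.
  (* The factor exp |x| is absorbed into y as a shift by 1 or -1, according to the sign of x; the
     sum of the two bounds covers both cases. *)
  have /orP[x0|x0] := le_total 0 x.
    by apply: (le_trans (bound 1 _)); rewrite ?mul1r ?ger0_norm// lerDl.
  by apply: (le_trans (bound (-1) _)); rewrite ?mulN1r ?ler0_norm// lerDr.
- move=> x; under eq_fun do rewrite uE.
  have -> : expoly k.+1 y s x = expoly k y s x * x by rewrite /expoly (exprSr x k); ring.
  by apply: cvgMl_tmp; exact: cvg_expR_slope.
Qed.

Lemma agree_expolyX s : 0 < s -> (forall y, agree (expoly 0 y s)) ->
  forall k y, agree (expoly k y s).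
Proof. by move=> s0 a0; elim=> // k; exact: agree_expolyS. Qed.

(* exp(- t x^2) is expanded in power series; dominating the partial sums by
   exp(t x^2) requires t < s. *)
Lemma agree_expoly_step s t : 0 <= t < s -> (forall y, agree (expoly 0 y s)) ->
  forall y, agree (expoly 0 y (s + t)).
Proof.
move=> /andP[t0 ts] a0 y; have s0 := le_lt_trans t0 ts.
have ak := agree_expolyX s0 a0.
pose u n x := \sum_(0 <= k < n) ((- t) ^+ k / k`!%:R * expoly (2 * k) y s x).
have uE n x : u n x = series (exp_coeff (- (t * x ^+ 2))) n * expoly 0 y s x.
  rewrite /u /series /= mulr_suml; apply: eq_bigr => k _.
  by rewrite /expoly /exp_coeff/= expr0 mul1r -(mulNr t) exprMn exprM; ring.
pose B : R := 0`!%:R * expR ((`|y| + 1) ^+ 2 / (4 * (s - t))).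
apply: (@agree_lim u _ B).
- by move=> n; apply: agree_sum => k _; apply: agreeZ; exact: ak.
- move=> n x; rewrite uE normrM.
  apply: (le_trans (ler_wpM2r (normr_ge0 _) (series_exp_coeff_norm_le _ _))).
  have tx : 0 <= t * x ^+ 2 by rewrite mulr_ge0 ?sqr_ge0.
  rewrite normrN (ger0_norm tx).
  have st : 0 < s - t by rewrite subr_gt0.
  apply: le_trans (expoly_bound 0 y x st).
  rewrite /expoly !expr0 !mul1r !(ger0_norm (expR_ge0 _)) -expRD ler_expR.
  by rewrite le_eqVlt; apply/orP; left; apply/eqP; ring.
- move=> x; under eq_fun do rewrite uE.
  have -> : expoly 0 y (s + t) x = expR (- (t * x ^+ 2)) * expoly 0 y s x.
    by rewrite /expoly !expr0 !mul1r -expRD mulrDl opprD; congr expR; ring.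
  by apply: cvgMr_tmp; exact: cvg_series_exp_coeff.
Qed.

Hypothesis agree_tilt : forall y, \int[D1]_x tilt y x = c * \int[D2]_x tilt y x.

(** Steps of 1/4 are admissible in [agree_expoly_step], as s starts at 1/2 and only grows; 4 m + 2
    of them lead from 1/2 to m + 1. *)
Lemma agree_expoly_nat m y : (0 < m)%N -> agree (expoly 0 y m%:R).
Proof.
have H j z : agree (expoly 0 z (2^-1 + j%:R * 4^-1)).
  elim: j z => [|j IH] z.
    rewrite mul0r addr0 (_ : expoly _ _ _ = tilt z).
      by split; [exact: bounded_measurable_tilt|exact: agree_tilt].
    by apply/funext => x; rewrite tiltE.
  rewrite -[j.+1%:R]natr1 mulrDl mul1r addrA; apply: agree_expoly_step => //.
  have : 0 <= j%:R * 4^-1 :> R by rewrite divr_ge0.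
  lra.
case: m => // m _.
have -> : m.+1%:R = 2^-1 + (4 * m + 2)%:R * 4^-1 :> R.
  by rewrite natrD natrM -[m.+1%:R]natr1; field.
exact: H.
Qed.

(* The term - n%:R makes bump tend to 0 on the boundary (x - a)^2 = r too. *)
Definition bump a r (n : nat) x : R := expR (- (n%:R ^+ 2 * ((x - a) ^+ 2 - r)) - n%:R).

(** Powers of a bump have the natural number k n^2 as quadratic coefficient, the case settled by
    [agree_expoly_nat]. *)
Lemma bumpXE a r n k x : bump a r n x ^+ k =
  expR (k%:R * (n%:R ^+ 2 * (r - a ^+ 2) - n%:R)) *
  expoly 0 (2 * a * (k * n ^ 2)%:R) (k * n ^ 2)%:R x.
Proof.
rewrite /bump /expoly expr0 mul1r -expRM_natl -expRD natrM natrX; congr expR; ring.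
Qed.

Lemma bump_le a r n x : bump a r n x <= expR (n%:R ^+ 2 * r - n%:R).
Proof.
rewrite ler_expR lerD2r mulrBr opprB gerBl.
by rewrite mulr_ge0 ?sqr_ge0.
Qed.

Lemma agree_expbump a r n : (0 < n)%N -> agree (fun x => 1 - expR (- bump a r n x)).
Proof.
move=> n0.
(* The series of 1 - exp (- bump) has no constant term, so it starts at 1. *)
pose u m x := \sum_(1 <= k < m.+1) (- ((-1) ^+ k / k`!%:R)) * bump a r n x ^+ k.
have uE m x : u m x = 1 - series (exp_coeff (- bump a r n x)) m.+1.
  rewrite /series /= big_nat_recl//= /exp_coeff/= expr0 fact0 divr1 opprD addrA subrr add0r.
  rewrite -sumrN /u big_add1; apply: eq_bigr => k _.
  by rewrite [in RHS]exprNn; ring.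
apply: (@agree_lim u _ (1 + expR (expR (n%:R ^+ 2 * r - n%:R)))).
- move=> m; apply: agree_sum => k k0; apply: agreeZ.
  under eq_fun do rewrite bumpXE.
  by apply: agreeZ; apply: agree_expoly_nat; rewrite muln_gt0 k0 expn_gt0 n0.
- move=> m x; rewrite uE (le_trans (ler_normB _ _))// normr1 lerD2l.
  rewrite (le_trans (series_exp_coeff_norm_le _ _))// ler_expR normrN ger0_norm ?expR_ge0//.
  exact: bump_le.
- move=> x; under eq_fun do rewrite uE.
  apply: cvgB; first exact: cvg_cst.
  by rewrite (cvg_shiftS (series (exp_coeff (- bump a r n x)))); exact: cvg_series_exp_coeff.
Qed.

(** Inside, the bump b tends to infinity; on the boundary and outside, 1 - exp (- b) <= b <= exp (-
    (n + 1)). *)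
Lemma cvg_expbump a r x :
  (fun n : nat => 1 - expR (- bump a r n.+1 x)) @ \oo -->
  (((x - a) ^+ 2 < r)%R%:R : R).
Proof.
have [xr|xr] := ltP ((x - a) ^+ 2) r.
  pose e := r - (x - a) ^+ 2; have e0 : 0 < e by rewrite subr_gt0.
  have l : (fun n : nat => expR (- bump a r n.+1 x)) @ \oo --> (0 : R).
    apply: (@squeeze_cvgr _ _ _ _ (fun=> 0) (fun n : nat => expR e^-1 * expR (- n.+1%:R))).
    - apply: nearW => n; rewrite expR_ge0/= -expRD ler_expR.
      apply: (@le_trans _ _ (- (n.+1%:R ^+ 2 * e - n.+1%:R))).
        rewrite lerN2 /bump.
        have -> : - (n.+1%:R ^+ 2 * ((x - a) ^+ 2 - r)) - n.+1%:R = n.+1%:R ^+ 2 * e - n.+1%:R.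
          by rewrite /e; ring.
        by rewrite (le_trans _ (expR_ge1Dx _))// lerDr.
      (* Writing n for [n.+1], this square gives n^2 e - n >= n - 1 / e, a linear lower bound. *)
      have : 0 <= (n.+1%:R * e - 1) ^+ 2 / e by rewrite divr_ge0 ?sqr_ge0// ltW.
      have -> : (n.+1%:R * e - 1) ^+ 2 / e = n.+1%:R ^+ 2 * e - 2 * n.+1%:R + e^-1.
        by field; rewrite gt_eqF.
      by lra.
    - exact: cvg_cst.
    - have -> : (0 : R) = expR e^-1 * 0 by rewrite mulr0.
      apply: cvgMl_tmp; have := @cvgn_expR R; rewrite -(cvg_shiftS (fun n => expR (- n%:R))).
      exact.
  have -> : (true%:R : R) = 1 - 0 by rewrite subr0.
  by apply: cvgB => //; exact: cvg_cst.
apply: (@squeeze_cvgr _ _ _ _ (fun=> 0) (fun n : nat => expR (- n.+1%:R))).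
- apply: nearW => n; apply/andP; split.
    by rewrite subr_ge0 expR_le1 oppr_le0 expR_ge0.
  apply: (@le_trans _ _ (bump a r n.+1 x)).
    by have := expR_ge1Dx (- bump a r n.+1 x); lra.
  by rewrite ler_expR gerDr oppr_le0 mulr_ge0 ?sqr_ge0 ?subr_ge0.
- exact: cvg_cst.
- have := @cvgn_expR R; rewrite -(cvg_shiftS (fun n => expR (- n%:R))).
  exact.
Qed.

Lemma agree_ball a r : agree (fun x => ((x - a) ^+ 2 < r)%R%:R).
Proof.
apply: (@agree_lim (fun n x => 1 - expR (- bump a r n.+1 x)) _ 1) => [n|n x|].
- exact: agree_expbump.
- by rewrite ger0_norm ?gerBl ?expR_ge0// subr_ge0 expR_le1 oppr_le0 expR_ge0.
- exact: cvg_expbump.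
Qed.

(** The balls of squared radius n about 0 exhaust the line. *)
Lemma agree_cst1 : agree (fun=> 1).
Proof.
apply: (@agree_lim (fun n x => ((x - 0) ^+ 2 < n%:R)%R%:R) _ 1).
- by move=> n; exact: agree_ball.
- by move=> n x; rewrite normr_nat lern1; case: (_ < _)%R.
- move=> x; apply: cvg_near_cst; near=> n.
  suff -> : (x - 0) ^+ 2 < n%:R by [].
  near: n; exact: nbhs_infty_gtr.
Unshelve. all: by end_near. Qed.

Lemma agree_c : c = 1.
Proof.
have [_] := agree_cst1; rewrite !Rintegral_cst//.
by rewrite [X in 1 * fine X = _](probability_setT D1)
  [X in _ = c * (1 * fine X)](probability_setT D2) !mulr1.
Qed.

(** The ball of centre z + n and radius n is the interval from z to z + 2 n, which grows to the
    ray. *)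
Lemma agree_ray z : agree \1_(`]z, +oo[).
Proof.
apply: (@agree_lim (fun n x => ((x - (z + n%:R)) ^+ 2 < n%:R ^+ 2)%R%:R) _ 1).
- by move=> n; exact: agree_ball.
- by move=> n x; rewrite normr_nat lern1; case: (_ < _)%R.
- move=> x; apply: cvg_near_cst; near=> n.
  rewrite indicE mem_setE in_itv/= andbT; congr (_%:R); congr nat_of_bool.
  have xn : x - z < n%:R by near: n; exact: nbhs_infty_gtr.
  have n0 : 0 <= n%:R :> R by [].
  apply/idP/idP => h; last by nra.
  rewrite ltNge; apply/negP => xz; move: h; rewrite ltNge => /negP; apply.
  by nra.
Unshelve. all: by end_near. Qed.

(** Open rays generate the Borel sets and are closed under intersection; as c = 1, the two laws
    coincide on them. *)
Lemma tilt_unique (A : set (measurableTypeR R)) : measurable A -> D1 A = D2 A.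
Proof.
apply: (@measure_unique _ R (measurableTypeR R) (@RGenOInfty.G R)
  (fun n => `]- n%:R, +oo[%classic)).
- exact: RGenOInfty.measurableE.
- move=> _ _ [x ->] [y ->]; exists (Num.max x y).
  apply/seteqP; split => t /=; rewrite !in_itv/= !andbT gt_max.
    by move=> [-> ->].
  by move/andP.
- by move=> n; exists (- n%:R).
- apply/seteqP; split => // x _; exists (Num.truncn `|x|).+1 => //=.
  rewrite in_itv/= andbT ltrNl (le_lt_trans (ler_norm _))// normrN.
  by rewrite truncnS_gt.
- move=> _ [x ->]; have [_] := agree_ray x; rewrite agree_c mul1r.
  rewrite /Rintegral !integral_indic//= !setIT => E.
  by rewrite -[LHS]fineK ?fin_num_measure// -[RHS]fineK ?fin_num_measure// E.
- by move=> n; rewrite (le_lt_trans (probability_le1 D1 _))// ltry.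
Qed.

End uniqueness.

(** * The joint law of signal and observation *)
Lemma normal_pdf_center (R : realType) (m x : R) :
  normal_pdf m 1 x = normal_pdf 0 1 (x - m).
Proof. by rewrite !(normal_pdfE _ (oner_neq0 R)) normal_fun_center. Qed.

Section lebesgue_shift.
Context (R : realType).
Local Notation mu := (@lebesgue_measure R).
Local Open Scope ereal_scope.

Let measurable_shift (c : R) :
  measurable_fun setT ((fun x => x + c)%R : measurableTypeR R -> measurableTypeR R).
Proof. exact: (@measurable_funD _ (measurableTypeR R) R setT id (cst c)). Qed.

Lemma lebesgue_measure_shift (c : R) (A : set R) : measurable A ->
  pushforward mu ((fun x => x + c)%R : _ -> measurableTypeR R) A = mu A.
Proof.
move=> mA.
pose f : {mfun measurableTypeR R >-> measurableTypeR R} :=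
  HB.pack ((fun x => x + c)%R : measurableTypeR R -> measurableTypeR R)
    (isMeasurableFun.Build _ _ _ _ _ (measurable_shift c)).
apply/esym; rewrite (lebesgue_measure_unique (mu := pushforward mu f)) //= => _ [[a b]] _ <-.
rewrite /pushforward.
have -> : f @^-1` [set` `]a, b]%O] = [set` `](a - c)%R, (b - c)%R]%O].
  by apply/seteqP; split => x /=; rewrite !in_itv/= ltrBlDr lerBrDr.
rewrite !lebesgue_measure_itv/= !lte_fin ltrD2r; case: ifP => // _.
by rewrite -!EFinB; congr EFin; lra.
Qed.

Lemma ge0_integral_shift (c : R) (f : R -> \bar R) :
  measurable_fun setT f -> (forall x, 0 <= f x) ->
  \int[mu]_x f (x + c)%R = \int[mu]_x f x.
Proof.
move=> mf f0.
have := @ge0_integral_pushforward _ _ (measurableTypeR R) (measurableTypeR R) R _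
  (measurable_shift c) mu setT f measurableT mf (fun x _ => f0 x).
rewrite preimage_setT => <-.
by apply: eq_measure_integral => /= A mA _; exact: lebesgue_measure_shift.
Qed.

(** The Radon-Nikodym derivative of the normal law has the same integrals as [normal_pdf] over
    measurable sets, so both agree almost everywhere. *)
Lemma ge0_integral_normal_prob (m s : R) (f : R -> \bar R) :
  measurable_fun setT f -> (forall x, 0 <= f x) ->
  \int[normal_prob m s]_x f x = \int[mu]_x (f x * (normal_pdf m s x)%:E).
Proof.
move=> mf f0.
have dom := @normal_prob_dominates R m s.
rewrite -(Radon_Nikodym_SigmaFinite.change_of_variables dom f0 measurableT mf).
have mp : measurable_fun setT (fun x : R => (normal_pdf m s x)%:E).
  by apply/measurable_EFinP; exact: measurable_normal_pdf.
have iRN := Radon_Nikodym_SigmaFinite.f_integrable dom.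
apply: ae_eq_integral => //.
- by apply: emeasurable_funM => //; exact: measurable_int iRN.
- exact: emeasurable_funM.
- apply: ae_eqe_mul2l; apply: integral_ae_eq => // E _ mE.
  by rewrite -Radon_Nikodym_SigmaFinite.f_integral.
Qed.

Lemma ge0_integral_normal_shift (x : R) (f : R -> \bar R) :
  measurable_fun setT f -> (forall x, 0 <= f x) ->
  \int[normal_prob 0 1]_t f (x + t)%R =
  \int[mu]_y (f y * (normal_pdf x 1 y)%:E).
Proof.
move=> mf f0.
have mfx : measurable_fun setT (fun t => f (x + t)%R).
  by apply: measurableT_comp => //; exact: measurable_funD.
rewrite (ge0_integral_normal_prob 0 1 mfx (fun t => f0 _)).
rewrite -(@ge0_integral_shift x (fun y => f y * (normal_pdf x 1 y)%:E)).
- apply: eq_integral => t _; rewrite [(x + t)%R]addrC; congr (_ * _%:E).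
  by rewrite (normal_pdf_center x) addrK.
- apply: emeasurable_funM => //; apply/measurable_EFinP; exact: measurable_normal_pdf.
- by move=> y; rewrite mule_ge0// lee_fin normal_pdf_ge0.
Qed.

End lebesgue_shift.

Section joint_law.
Context d (T : measurableType d) (R : realType) (P : probability T R).
Variables X N : {RV P >-> measurableTypeR R}.
Hypotheses (hN : has_normal_law P (N : T -> R) 0 1)
  (hXN : indep_rv P (X : T -> R) (N : T -> R)).
Local Notation mu := (@lebesgue_measure R).
Local Notation D := (distribution P X).
Local Notation RR := (measurableTypeR R * measurableTypeR R)%type.
Local Open Scope ereal_scope.

Let measurable_pair : measurable_fun setT (fun w => (X w, N w) : RR).
Proof.
exact: measurable_fun_pair (@measurable_funPT _ _ _ _ X) (@measurable_funPT _ _ _ _ N).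
Qed.

Lemma measurable_gauss_kernel :
  measurable_fun setT (fun z : RR => (normal_pdf z.1 1 z.2)%:E).
Proof.
apply/measurable_EFinP.
rewrite (_ : (fun z => _) = fun z : RR => normal_pdf 0 1 (z.2 - z.1)).
  apply: measurableT_comp; first exact: measurable_normal_pdf.
  by apply: measurable_funB.
by apply/funext => z; exact: normal_pdf_center.
Qed.

(** The pair (X, X + N) has density [normal_pdf z.1 1 z.2] against the product of [D] and Lebesgue
    measure: Tonelli reduces this to a shift by a fixed x. *)
Lemma ge0_integral_joint (k : RR -> \bar R) :
  measurable_fun setT k -> (forall z, 0 <= k z) ->
  \int[P]_w k (X w, X w + N w)%R =
  \int[D \x mu]_z (k z * (normal_pdf z.1 1 z.2)%:E).
Proof.
move=> mk k0.
pose k' (z : RR) := k (z.1, z.1 + z.2)%R.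
have mk' : measurable_fun setT k'.
  apply: measurableT_comp => //; apply: measurable_fun_pair => //.
  exact: measurable_funD.
have -> : \int[P]_w k (X w, X w + N w)%R =
    \int[pushforward P (fun w => (X w, N w) : RR)]_z k' z.
  rewrite (ge0_integral_pushforward measurable_pair P measurableT mk' (fun z _ => k0 _)).
  by rewrite preimage_setT.
(* Independence enters here: the law of (X, N) is the product measure, since both agree on
   rectangles. *)
transitivity (\int[D \x normal_prob 0 1]_z k' z).
  pose f : {mfun T >-> RR} := HB.pack (fun w => (X w, N w) : RR)
    (isMeasurableFun.Build _ _ _ _ _ measurable_pair).
  apply: (@eq_measure_integral _ _ R setT (D \x normal_prob 0 1) (pushforward P f)).
  move=> A mA _; apply/esym.
  apply: (product_measure_unique (m' := pushforward P f)) => //= A1 A2 mA1 mA2.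
  by rewrite /pushforward /= -hN// -hXN//; congr (P _).
rewrite (fubini_tonelli1 (m1 := D) (m2 := normal_prob 0 1) _ mk' (fun z => k0 _)).
rewrite fubini_tonelli1; last 2 first.
- by apply: emeasurable_funM => //; exact: measurable_gauss_kernel.
- by move=> z; rewrite mule_ge0// lee_fin normal_pdf_ge0.
apply: eq_integral => x _; rewrite /fubini_F /k' /=.
apply: (ge0_integral_normal_shift x (f := fun y => k (x, y))) => //.
by apply: measurableT_comp => //; apply: measurable_fun_pair.
Qed.

Lemma integral_joint (r : RR -> R) : measurable_fun setT r ->
  \int[P]_w (r (X w, X w + N w)%R)%:E =
  \int[D \x mu]_z (r z * normal_pdf z.1 1 z.2)%:E.
Proof.
move=> mr; rewrite integralE [RHS]integralE.
have mE : measurable_fun setT (EFin \o r) by exact/measurable_EFinP.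
have p0 z : (0 <= normal_pdf z.1 1 z.2 :> R)%R by exact: normal_pdf_ge0.
have posE : (fun z : RR => (r z * normal_pdf z.1 1 z.2)%:E)^\+ =
    fun z => (EFin \o r)^\+ z * (normal_pdf z.1 1 z.2)%:E.
  apply/funext => z; rewrite !funeposE/= -!EFin_max -EFinM; congr EFin.
  by rewrite maxr_pMl// mul0r.
have negE : (fun z : RR => (r z * normal_pdf z.1 1 z.2)%:E)^\- =
    fun z => (EFin \o r)^\- z * (normal_pdf z.1 1 z.2)%:E.
  apply/funext => z; rewrite !funenegE/= -!EFin_max -EFinM; congr EFin.
  by rewrite maxr_pMl// mul0r mulNr.
rewrite posE negE -!ge0_integral_joint//; last 2 first.
- exact: measurable_funeneg.
- exact: measurable_funepos.
by congr (_ - _); apply: eq_integral => w _; rewrite ?funeposE ?funenegE.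
Qed.

Lemma integrable_joint (r : RR -> R) : measurable_fun setT r ->
  P.-integrable setT (fun w => (r (X w, X w + N w)%R)%:E) ->
  (D \x mu).-integrable setT (fun z => (r z * normal_pdf z.1 1 z.2)%:E).
Proof.
move=> mr /integrableP[_ ir]; apply/integrableP; split.
  under eq_fun do rewrite EFinM.
  apply: emeasurable_funM; first exact/measurable_EFinP.
  exact: measurable_gauss_kernel.
suff -> : \int[D \x mu]_z `|(r z * normal_pdf z.1 1 z.2)%:E| =
    \int[P]_w `|(r (X w, X w + N w)%R)%:E| by [].
rewrite (@ge0_integral_joint (fun z => `|(r z)%:E|))//.
  by apply: eq_integral => z _; rewrite EFinM abseM [X in _ * X]gee0_abs// lee_fin normal_pdf_ge0.
by apply: measurableT_comp => //; exact/measurable_EFinP.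
Qed.

End joint_law.

(** * Continuity of the tilted moments in the observation *)

Section tilted_moments.
Context (R : realType) (D : probability (measurableTypeR R) R).
Local Notation mu := (@lebesgue_measure R).

(** The posterior mean at y minus [q y], multiplied by [tilt_mass D y] to avoid a quotient. *)
Definition posterior_gap (q : R -> R) (y : R) : R :=
  \int[D]_x ((x - q y) * tilt y x).

Lemma normal_pdf_tilt (x y : R) :
  normal_pdf x 1 y = normal_pdf 0 1 y * tilt y x.
Proof.
rewrite !(normal_pdfE _ (oner_neq0 R)) /normal_fun /tilt -mulrA -expRD.
by congr (_ * expR _); rewrite expr1n; field.
Qed.

Lemma cvg_posterior_gap (q : R -> R) (u : nat -> R) (y : R) :
  u @ \oo --> y -> q \o u @ \oo --> q y ->
  (fun n => posterior_gap q (u n)) @ \oo --> posterior_gap q y.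
Proof.
move=> uy quy.
(* A convergent sequence is bounded, so [expoly_bound] yields one dominating constant for all n. *)
have [M uM] : exists M, forall n, `|u n| <= M.
  have /cvg_seq_bounded [M [_ HM]] : cvgn u by apply/cvg_ex; exists y.
  by exists (M + 1) => n; apply: (HM (M + 1)) => //; rewrite ltrDl.
have lim k : (fun n => \int[D]_x (x ^+ k * expR (u n * x - 2^-1 * x ^+ 2))) @ \oo -->
    \int[D]_x (x ^+ k * expR (y * x - 2^-1 * x ^+ 2)).
  apply: (@cvg_Rintegral_bounded _ _ _ D _ _
      (k`!%:R * expR ((M + 1) ^+ 2 / (4 * 2^-1)))).
  - by move=> n; exact: measurable_expoly.
  - move=> n x; rewrite (le_trans (expoly_bound _ _ _ _))// ler_wpM2l// ler_expR.
    by rewrite ler_wpM2r// ler_sqr ?nnegrE ?addr_ge0 ?lerD// (le_trans (normr_ge0 _) (uM 0%N)).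
  - move=> x; apply: cvgMl_tmp; apply: continuous_cvg; first exact: continuous_expR.
    by apply: cvgB; [exact: cvgMr_tmp|exact: cvg_cst].
have gapE z : posterior_gap q z =
    \int[D]_x (x ^+ 1 * expR (z * x - 2^-1 * x ^+ 2)) -
    q z * \int[D]_x (x ^+ 0 * expR (z * x - 2^-1 * x ^+ 2)).
  rewrite /posterior_gap Rintegral_sub_tilt; congr (_ - _ * _).
    by apply: eq_Rintegral => x _; rewrite mul_tiltE.
  by apply: eq_Rintegral => x _; rewrite tiltE.
rewrite gapE; under eq_fun do rewrite gapE.
by apply: cvgB; [exact: lim|apply: cvgM => //; exact: lim].
Qed.

(** A null set contains no interval of positive length, so zeros of the gap accumulate at y from the
    right; continuity concludes. *)
Lemma posterior_gap_eq0 (q : {poly R}) :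
  {ae mu, forall y, posterior_gap (horner q) y = 0} ->
  forall y, posterior_gap (horner q) y = 0.
Proof.
move=> [A [mA A0 subA]] y.
have near_zero n : exists z, y < z < y + n.+1%:R^-1 /\ posterior_gap (horner q) z = 0.
  apply: contrapT => H.
  have : (mu `]y, (y + n.+1%:R^-1)%R[%classic <= mu A)%E.
    apply: le_measure; rewrite ?inE; [exact: (@measurable_itv R)|exact: mA|].
    move=> z /=; rewrite in_itv/= => zy; apply: subA => /= gz.
    by apply: H; exists z.
  rewrite A0 lebesgue_measure_itv/= lte_fin ltrDl invr_gt0 ltr0n/= -EFinB lee_fin.
  by rewrite addrAC subrr add0r leNgt invr_gt0 ltr0n.
have [u Hu] := choice near_zero.
have uy : u @ \oo --> y.
  apply: (@squeeze_cvgr _ _ _ _ (fun=> y) (fun n => y + n.+1%:R^-1)).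
  - by apply: nearW => n; have [/andP[/ltW -> /ltW ->]] := Hu n.
  - exact: cvg_cst.
  - rewrite -[X in _ --> X]addr0; apply: cvgD; first exact: cvg_cst.
    exact: cvg_harmonic.
have quy : horner q \o u @ \oo --> q.[y].
  by apply: continuous_cvg => //; exact: continuous_horner.
have := cvg_posterior_gap uy quy.
under eq_fun do rewrite (Hu _).2.
by move=> h; exact: (cvg_unique _ h (cvg_cst _)).
Qed.

End tilted_moments.

(** * Gaussian priors *)

Section gaussian_prior.
Context (R : realType).
Local Notation mu := (@lebesgue_measure R).

(** Gaussian conjugacy: by completing the square, the tilted normal density is a multiple of the
    normal density with mean a y + b and variance a. *)
Lemma tilt_mass_normal (m s : R) : 0 < s -> exists2 K : R, 0 < K &
  forall y, tilt_mass (normal_prob m s) y =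
    K * expR (s ^+ 2 / (1 + s ^+ 2) * y ^+ 2 / 2 + m / (1 + s ^+ 2) * y).
Proof.
move=> s0; have s20 : 0 < s ^+ 2 by rewrite exprn_gt0.
have s1 : 0 < 1 + s ^+ 2 by rewrite addr_gt0.
set a := s ^+ 2 / (1 + s ^+ 2); set b := m / (1 + s ^+ 2).
have a0 : 0 < a by rewrite divr_gt0.
have sn0 : s != 0 by rewrite gt_eqF.
have ra0 : Num.sqrt a != 0 by rewrite gt_eqF// sqrtr_gt0.
(* The quotient of peaks corrects the normalisation; the exponential collects the terms free of x
   and y. *)
pose K := normal_peak s / normal_peak (Num.sqrt a) *
  expR (m ^+ 2 / (1 + s ^+ 2) / s ^+ 2 / 2 - m ^+ 2 / s ^+ 2 / 2).
have p0 : 0 < normal_peak s by apply: normal_peak_gt0.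
have pa0 : 0 < normal_peak (Num.sqrt a) by apply: normal_peak_gt0.
exists K; first by rewrite mulr_gt0 ?expR_gt0// divr_gt0.
move=> y.
have E x : tilt y x * normal_pdf m s x =
    K * expR (a * y ^+ 2 / 2 + b * y) * normal_pdf (a * y + b) (Num.sqrt a) x.
  rewrite !normal_pdfE// /normal_fun sqr_sqrtr ?ltW// /K /tilt.
  set p := normal_peak s; set p' := normal_peak (Num.sqrt a).
  have p'0 : p' != 0 by rewrite gt_eqF.
  have -> (e1 e2 e3 : R) : p / p' * expR e1 * expR e2 * (p' * expR e3) = expR (e1 + e2 + e3) * p.
    by rewrite !expRD; field.
  have -> (e1 e2 : R) : expR e1 * (p * expR e2) = expR (e1 + e2) * p.
    by rewrite expRD; ring.
  congr (expR _ * _); rewrite /a /b; field.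
  by rewrite !gt_eqF.
rewrite /tilt_mass /Rintegral.
rewrite (ge0_integral_normal_prob m s (f := fun x => (tilt y x)%:E)); last 2 first.
- by apply/measurable_EFinP; have [] := bounded_measurable_tilt y.
- by move=> x; rewrite lee_fin expR_ge0.
under eq_integral do rewrite -EFinM E EFinM.
rewrite integralZl//; last exact: integrable_normal_pdf.
by rewrite integral_normal_pdf mule1.
Qed.

(** |x| <= 1 + 3/8 x^2 <= exp (3/8 x^2), and 1/2 - 3/8 = 1/8: the integrand is below a multiple of
    the density of standard deviation 2. *)
Lemma integrable_normal_id :
  (normal_prob (0 : R) 1).-integrable setT (fun x : R => x%:E).
Proof.
apply/integrableP; split; first exact/measurable_EFinP.
rewrite (ge0_integral_normal_prob 0 1 (f := fun x => `|x%:E|%E)); last 2 first.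
- by apply: measurableT_comp => //; exact/measurable_EFinP.
- by move=> x; exact: abse_ge0.
pose C : R := normal_peak 1 / normal_peak 2.
have n2 : (2 : R) != 0 by rewrite pnatr_eq0.
have p2 := normal_peak_gt0 n2.
apply: (@le_lt_trans _ _ (\int[mu]_x (C%:E * (normal_pdf 0 2 x)%:E))%E).
  apply: ge0_le_integral => //.
  - by move=> x _; rewrite mule_ge0// lee_fin normal_pdf_ge0.
  - apply: emeasurable_funM; last by apply/measurable_EFinP; exact: measurable_normal_pdf.
    by apply: measurableT_comp => //; exact/measurable_EFinP.
  - by apply: emeasurable_funM => //; apply/measurable_EFinP; exact: measurable_normal_pdf.
  - move=> x _; rewrite -!EFinM lee_fin (normal_pdfE _ (oner_neq0 R)) (normal_pdfE _ n2).
    rewrite /C [leRHS]mulrA divfK ?gt_eqF// [leLHS]mulrCA ler_wpM2l ?normal_peak_ge0//.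
    rewrite /normal_fun subr0 expr1n.
    have x1 : `|x| <= 1 + 3 / 8 * x ^+ 2.
      have := sqr_ge0 (3 / 4 * `|x| - 1); rewrite -[x ^+ 2]real_normK ?num_real// !expr2.
      by have := sqr_ge0 `|x|; rewrite expr2; lra.
    apply: (le_trans (ler_wpM2r (expR_ge0 _) (le_trans x1 (expR_ge1Dx _)))).
    by rewrite -expRD ler_expR le_eqVlt; apply/orP; left; apply/eqP; field.
rewrite integralZl//; last exact: integrable_normal_pdf.
by rewrite integral_normal_pdf mule1 ltry.
Qed.

End gaussian_prior.

(** * Conditional expectation in terms of the posterior gap *)

Section conditional_expectation.
Context d (T : measurableType d) (R : realType) (P : probability T R).
Variables X N : {RV P >-> measurableTypeR R}.
Hypotheses (hN : has_normal_law P (N : T -> R) 0 1)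
  (hXN : indep_rv P (X : T -> R) (N : T -> R))
  (iX : P.-integrable setT (fun w => (X w : R)%:E)).
Local Notation mu := (@lebesgue_measure R).
Local Notation D := (distribution P X).
Local Notation Y := (fun w => (X w + N w)%R : R).
Local Notation gap := (posterior_gap D).

Lemma measurable_noisy : measurable_fun setT (Y : T -> R).
Proof.
apply: measurable_funD; [exact: (@measurable_funPT _ _ _ _ X)|exact: (@measurable_funPT _ _ _ _ N)].
Qed.

Section fixed_regression.
Variable q : R -> R.
Hypotheses (mq : measurable_fun setT q)
  (iq : P.-integrable setT (fun w => (q (Y w))%:E)).

(** The event that Y lies in [B] enters as a factor, so that the joint-law formulas over the whole
    space apply. *)
Let kernel (B : set R) (z : measurableTypeR R * measurableTypeR R) : R :=
  (z.1 - q z.2) * \1_B z.2.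

Let measurable_kernel B : measurable B -> measurable_fun setT (kernel B).
Proof.
move=> mB; apply: measurable_funM.
  by apply: measurable_funB => //; exact: measurableT_comp.
by apply: measurableT_comp => //; exact: measurable_indic.
Qed.

Let integrable_kernel B : measurable B ->
  P.-integrable setT (fun w => (kernel B (X w, Y w))%:E).
Proof.
move=> mB; have iXq := integrableB measurableT iX iq.
apply: le_integrable iXq => //.
  apply/measurable_EFinP; apply: (measurableT_comp (measurable_kernel mB)).
  apply: measurable_fun_pair; [exact: (@measurable_funPT _ _ _ _ X)|exact: measurable_noisy].
move=> w _; rewrite -EFinB !abse_EFin lee_fin normrM ler_piMr//.
by rewrite indicE; case: (_ \in _); rewrite /= ?normr1 ?normr0.
Qed.

Let integral_kernel_slice B y :
  (\int[D]_x (kernel B (x, y) * normal_pdf x 1 y)%:E =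
   (\1_B y * (normal_pdf 0 1 y * gap q y))%:E)%E.
Proof.
have b := bounded_measurableZ (\1_B y * normal_pdf 0 1 y) (bounded_measurable_sub_tilt (q y) y).
rewrite mulrA /posterior_gap -RintegralZl//; last first.
  exact/bounded_measurable_integrable/bounded_measurable_sub_tilt.
rewrite /Rintegral fineK; last first.
  exact: (integrable_fin_num measurableT (bounded_measurable_integrable D b)).
apply: eq_integral => x _; congr EFin.
by rewrite /kernel/= normal_pdf_tilt; ring.
Qed.

(** This is the slice integral of [kernel setT]; Tonelli bounds its absolute integral by that of the
    joint integrand. *)
Lemma integrable_posterior_gap :
  mu.-integrable setT (fun y => (normal_pdf 0 1 y * gap q y)%:E).
Proof.
have i := integrable_joint hN hXN (measurable_kernel measurableT) (integrable_kernel measurableT).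
have E : (fun y => (normal_pdf 0 1 y * gap q y)%:E) =
    fubini_G D (fun z => (kernel setT z * normal_pdf z.1 1 z.2)%:E).
  by apply/funext => y; rewrite /fubini_G integral_kernel_slice indicT mul1r.
have mG := measurable_fubini_G i.
rewrite E; apply/integrableP; split; first exact: mG.
have mi := measurable_int _ i.
pose f (z : measurableTypeR R * measurableTypeR R) : \bar R :=
  (kernel setT z * normal_pdf z.1 1 z.2)%:E.
have mf : measurable_fun setT (abse \o f) by apply: measurableT_comp.
apply: le_lt_trans ((integrable21ltyP _ _ mi).1 i).
apply: ge0_le_integral => //.
- by apply: measurableT_comp => //; exact: mG.
- exact: (measurable_fun_fubini_tonelli_G (m1 := D) (abse \o f) mf (fun z => abse_ge0 _)).
- move=> y _; apply: le_abse_integral => //.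
  exact: (@measurable_fun_pair1 _ _ _ _ _ _ f y mi).
Qed.

(** Fubini for the joint law, with x integrated first, turns the defect in the defining identity of
    E[X | Y] = q(Y) into an integral of the gap. *)
Lemma integral_cond_gap (B : set R) : measurable B ->
  (\int[P]_(w in Y @^-1` B) (X w : R)%:E - \int[P]_(w in Y @^-1` B) (q (Y w))%:E =
   \int[mu]_(y in B) (normal_pdf 0 1 y * gap q y)%:E)%E.
Proof.
move=> mB.
have mYB : measurable (Y @^-1` B) by rewrite -[X in measurable X]setTI; exact: measurable_noisy.
rewrite -integralB//; last 2 first.
- exact: integrableS iX.
- exact: integrableS iq.
transitivity (\int[P]_w (kernel B (X w, Y w))%:E)%E.
  rewrite integral_mkcond; apply: eq_integral => w _.
  rewrite /kernel patchE /= indicE.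
  have -> : (w \in Y @^-1` B) = (X w + N w \in B) by apply/idP/idP; rewrite !inE.
  by case: ifP => _; rewrite ?mulr1 ?mulr0.
rewrite (integral_joint hN hXN (measurable_kernel mB)).
have i := integrable_joint hN hXN (measurable_kernel mB) (integrable_kernel mB).
rewrite -(integral21_prod_meas1 i).
rewrite [RHS]integral_mkcond; apply: eq_integral => y _.
rewrite /fubini_G integral_kernel_slice patchE indicE.
by case: ifP => _; rewrite ?mul1r ?mul0r.
Qed.

End fixed_regression.

(** The weighted gap integrates to 0 over every Borel set, so it vanishes almost everywhere; the
    normal density is positive, and [posterior_gap_eq0] reaches every y. *)
Lemma cond_exp_gap0 (q : {poly R}) :
  is_cond_exp P (X : T -> R) Y (fun w => q.[Y w]) -> forall y, gap (horner q) y = 0.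
Proof.
move=> [_ iq Eq]; have mq : measurable_fun setT (horner q) by exact: measurable_poly.
apply: posterior_gap_eq0.
have i := integrable_posterior_gap mq iq.
have : ae_eq mu setT (fun y => (normal_pdf 0 1 y * gap (horner q) y)%:E) (cst 0%E).
  apply: integral_ae_eq => //= E _ mE.
  have mYE : measurable (Y @^-1` E) by rewrite -[X in measurable X]setTI; exact: measurable_noisy.
  rewrite -integral_cond_gap// Eq// integral0 subee//.
  by apply: integrable_fin_num => //; exact: integrableS iq.
apply: filterS => y /(_ I) [] /eqP; rewrite mulf_eq0 => /orP[|/eqP//].
by rewrite (normal_pdfE _ (oner_neq0 R)) mulf_eq0 !gt_eqF ?expR_gt0 ?normal_peak_gt0.
Qed.

Lemma gap0_cond_exp (q : {poly R}) :
  P.-integrable setT (fun w => q.[Y w]%:E) -> (forall y, gap (horner q) y = 0) ->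
  is_cond_exp P (X : T -> R) Y (fun w => q.[Y w]).
Proof.
move=> iq gap0; have mq : measurable_fun setT (horner q) by exact: measurable_poly.
split => //.
  move=> A mA; exists (horner q @^-1` A); split => //.
  by rewrite -[X in measurable X]setTI; exact: mq.
move=> B mB; have mYB : measurable (Y @^-1` B).
  by rewrite -[X in measurable X]setTI; exact: measurable_noisy.
have := integral_cond_gap mq iq mB.
under [in RHS]eq_integral do rewrite gap0 mulr0.
rewrite integral0 => e.
have fin : (\int[P]_(w in Y @^-1` B) (q.[Y w])%:E)%E \is a fin_num.
  by apply: integrable_fin_num => //; exact: integrableS iq.
by rewrite -[LHS](subeK _ fin) e add0e.
Qed.

End conditional_expectation.

(** * Laws of the signal with polynomial regression *)

Lemma horner_size2 (R : nzRingType) (q : {poly R}) : (size q <= 2)%N ->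
  forall y, q.[y] = q`_1 * y + q`_0.
Proof.
move=> q2 y; rewrite (horner_coef_wide _ q2) big_ord_recl big_ord1 /=.
by rewrite expr0 expr1 mulr1 addrC.
Qed.

Section polynomial_regression.
Context d (T : measurableType d) (R : realType) (P : probability T R).
Variables X N : {RV P >-> measurableTypeR R}.
Hypotheses (hN : has_normal_law P (N : T -> R) 0 1)
  (hXN : indep_rv P (X : T -> R) (N : T -> R))
  (iX : P.-integrable setT (fun w => (X w : R)%:E)).
Local Notation D := (distribution P X).
Local Notation Y := (fun w => (X w + N w)%R : R).

Lemma polynomial_cond_exp_law (q : {poly R}) :
  is_cond_exp P (X : T -> R) Y (fun w => q.[Y w]) ->
  (exists m s : R, 0 < s /\ has_normal_law P (X : T -> R) m s) \/
  (exists c : R, {ae P, forall w, (X w : R) = c}).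
Proof.
move=> /(cond_exp_gap0 hN hXN iX) gap0.
have q2 := tilt_poly_size gap0.
have qE := horner_size2 q2; set a := q`_1 in qE; set b := q`_0 in qE.
have H y : \int[D]_x ((x - (a * y + b)) * tilt y x) = 0.
  by rewrite -(gap0 y) /posterior_gap qE.
have a0 := slope_ge0 H; have a1 := slope_lt1 H.
have [a0'|an0] := eqVneq a 0.
  right; exists b.
  have Db : D [set b] = 1%E.
    by apply: posterior_const => y; rewrite -(H y) a0' mul0r add0r.
  exists (X @^-1` ~` [set b]); split.
  - rewrite -[X in measurable X]setTI; apply: (@measurable_funPT _ _ _ _ X) => //.
    by apply: measurableC; exact: measurable_set1.
  - have : D (~` [set b]) = (1 - D [set b])%E.
      by apply: probability_setC; exact: measurable_set1.
    by rewrite Db subee.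
  - by move=> w /= Xw.
left; have ap : 0 < a by rewrite lt_neqAle eq_sym an0.
have b1 : 0 < 1 - a by rewrite subr_gt0.
(* Solves s^2 / (1 + s^2) = a and m / (1 + s^2) = b, matching the exponent in [tilt_mass_normal]. *)
pose m := b / (1 - a); pose s := Num.sqrt (a / (1 - a)).
have s0 : 0 < s by rewrite sqrtr_gt0 divr_gt0.
have s2 : s ^+ 2 = a / (1 - a) by rewrite sqr_sqrtr// divr_ge0 ?ltW.
exists m, s; split => // B mB.
have [K K0 HK] := tilt_mass_normal m s0.
have aE : s ^+ 2 / (1 + s ^+ 2) = a.
  by rewrite s2; field; rewrite subrK oner_neq0 gt_eqF.
have bE : m / (1 + s ^+ 2) = b.
  by rewrite s2 /m; field; rewrite subrK oner_neq0 gt_eqF.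
apply: (@tilt_unique R D (normal_prob m s) (tilt_mass D 0 / K)) => // y.
rewrite -!/(tilt_mass _ y) HK (tilt_mass_affine H) aE bE mulrA divfK ?gt_eqF//.
Qed.

(** Used to integrate affine functions of X + N. *)
Lemma integrable_noise : P.-integrable setT (fun w => (N w : R)%:E).
Proof.
have /integrableP[_ i] := integrable_normal_id R.
apply/integrableP; split; first by apply/measurable_EFinP; exact: (@measurable_funPT _ _ _ _ N).
apply: le_lt_trans i; rewrite le_eqVlt; apply/orP; left; apply/eqP.
transitivity (\int[distribution P N]_x `|(x : R)%:E|)%E.
  rewrite ge0_integral_distribution//.
  by apply: measurableT_comp => //; exact/measurable_EFinP.
by apply: eq_measure_integral => /= A mA _; exact: hN.
Qed.

Lemma normal_cond_exp (m s : R) : 0 < s -> has_normal_law P (X : T -> R) m s ->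
  exists q : {poly R}, is_cond_exp P (X : T -> R) Y (fun w => q.[Y w]).
Proof.
move=> s0 hX; pose a := s ^+ 2 / (1 + s ^+ 2); pose b := m / (1 + s ^+ 2).
have qE y : (a%:P * 'X + b%:P).[y] = a * y + b by rewrite !hornerE.
exists (a%:P * 'X + b%:P); apply: gap0_cond_exp => //.
  under eq_fun do rewrite qE EFinD EFinM.
  have ib := bounded_measurable_integrable P (@bounded_measurable_cst _ T R b).
  apply: (integrableD measurableT _ ib); apply: integrableZl => //.
  exact: (integrableD measurableT iX integrable_noise).
move=> y; rewrite /posterior_gap qE.
have [K K0 HK] := tilt_mass_normal m s0.
apply: (@posterior_mean_gaussian R D K) => [|z].
  by rewrite divr_ge0 ?addr_ge0 ?sqr_ge0.
rewrite -HK /tilt_mass /Rintegral; congr fine.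
by apply: eq_measure_integral => A mA _; exact: hX.
Qed.

Lemma constant_cond_exp (c : R) : {ae P, forall w, (X w : R) = c} ->
  exists q : {poly R}, is_cond_exp P (X : T -> R) Y (fun w => q.[Y w]).
Proof.
move=> Xc; exists c%:P; split.
(* A constant pulls [A] back to everything or to nothing, according to whether [c] lies in [A]. *)
- move=> A mA; exists [set y | A c]; split.
    have [Ac|nAc] := pselect (A c); last by rewrite (_ : [set _ | _] = set0)// predeqE.
    by rewrite (_ : [set _ | _] = setT)// predeqE.
  by apply/seteqP; split => w /=; rewrite hornerC.
- under eq_fun do rewrite hornerC.
  exact: (bounded_measurable_integrable P (@bounded_measurable_cst _ T R c)).
- move=> B mB; apply: ae_eq_integral.
  + by rewrite -[X in measurable X]setTI; exact: measurable_noisy.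
  + by apply/measurable_EFinP/measurable_funTS; exact: (@measurable_funPT _ _ _ _ X).
  + by under [X in measurable_fun _ X]eq_fun do rewrite hornerC; exact: measurable_cst.
  + by apply: filterS Xc => w -> _; rewrite hornerC.
Qed.

End polynomial_regression.

Theorem theorem2p2 (d : measure_display) (T : measurableType d) (R : realType)
    (P : probability T R) (X N : T -> R)
    (mX : measurable_fun setT X) (mN : measurable_fun setT N)
    (iX : P.-integrable setT (fun w => (X w)%:E))
    (hN : has_normal_law P N 0 1)
    (hXN : indep_rv P X N) :
  let Y := fun w => X w + N w in
  (~ exists q : {poly R}, (3 <= size q)%N /\ is_cond_exp P X Y (fun w => q.[Y w]))
  /\
  (P.-integrable setT (fun w => (X w ^+ 2)%:E) ->
    ((exists q : {poly R}, is_cond_exp P X Y (fun w => q.[Y w])) <->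
     ((exists m s : R, 0 < s /\ has_normal_law P X m s) \/
      (exists c : R, {ae P, forall w, X w = c})))).
Proof.
pose X' : {RV P >-> measurableTypeR R} := HB.pack (X : T -> measurableTypeR R)
  (isMeasurableFun.Build _ _ _ (measurableTypeR R) (X : T -> measurableTypeR R) mX).
pose N' : {RV P >-> measurableTypeR R} := HB.pack (N : T -> measurableTypeR R)
  (isMeasurableFun.Build _ _ _ (measurableTypeR R) (N : T -> measurableTypeR R) mN).
move=> Y; split.
  move=> [q [q3 /(@cond_exp_gap0 _ T R P X' N' hN hXN iX) gap0]].
  (* Size is degree plus one, so size at least 3 means degree at least 2. *)
  by have := tilt_poly_size gap0; rewrite leqNgt q3.
move=> _; split=> [[q cq]|[[m [s [s0 hX]]]|[c hc]]].
- exact: (@polynomial_cond_exp_law _ T R P X' N' hN hXN iX q cq).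
- exact: (@normal_cond_exp _ T R P X' N' hN hXN iX m s s0 hX).
- exact: (@constant_cond_exp _ T R P X' N' c hc).
Qed.
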